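(* Let $I$ be a non-empty set and let $E\subseteq\mathbb{R}^I$ be a linear subspace containing all $e_i$ ($i\in I$), endowed with a complete absolute normalised norm $\|\cdot\|_E$ such that $\operatorname{span}\{e_i:i\in I\}$ is dense in $E$. If $(X_i)_{i\in I}$ is a family of msluacs (resp. mluacs) Banach spaces and if $E$ is sluacs (resp. luacs) and has the property $(P)$, then $\bigl[\bigoplus_{i\in I}X_i\bigr]_E$ is also msluacs (resp. mluacs).
   Context: Banach spaces are real; $S_X$ denotes the unit sphere of $X$ and $X^*$ its dual. A Banach space $X$ is called - luacs if for every $x\in S_X$, every sequence $(x_n)$ in $S_X$ and every $x^*\in S_{X^*}$: $\|x_n+x\|\to 2$ and $x^*(x_n)\to 1$ imply $x^*(x)=1$; - sluacs if for every $x\in S_X$ and all sequences $(x_n)$ in $S_X$ and $(x_n^* )$ in $S_{X^*}$: $\|x_n+x\|\to 2$ and $x_n^*(x_n)\to 1$ imply $x_n^*(x)\to 1$; - mluacs if for all sequences $(x_n)$, $(y_n)$ in $S_X$, every $x\in S_X$ and every $x^*\in S_{X^*}$: $\|x-\tfrac{x_n+y_n}{2}\|\to 0$ and $x^*(x_n)\to 1$ imply $x^*(y_n)\to 1$; - msluacs if for all sequences $(x_n)$, $(y_n)$ in $S_X$, every $x\in S_X$ and every sequence $(x_n^* )$ in $S_{X^*}$: $\|x-\tfrac{x_n+y_n}{2}\|\to 0$ and $x_n^*(x_n)\to 1$ imply $x_n^*(y_n)\to 1$. For a non-empty set $I$, $e_i\in\mathbb{R}^I$ denotes the characteristic function of $\{i\}$.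 A norm $\|\cdot\|_E$ on a subspace $E$ of $\mathbb{R}^I$ (with all $e_i\in E$) is absolute if whenever $(a_i)_{i\in I}\in E$, $(b_i)_{i\in I}\in\mathbb{R}^I$ and $|a_i|=|b_i|$ for all $i\in I$, then $(b_i)_{i\in I}\in E$ and $\|(a_i)_{i\in I}\|_E=\|(b_i)_{i\in I}\|_E$; it is normalised if $\|e_i\|_E=1$ for every $i\in I$. $E$ has the property $(P)$ if for every sequence $(a_n)$ in $S_E$ and every $a\in S_E$, $\|a_n+a\|_E\to 2$ implies $a_n\to a$ pointwise on $I$. For a family $(X_i)_{i\in I}$ of Banach spaces, the absolute sum with respect to $E$ is $\bigl[\bigoplus_{i\in I}X_i\bigr]_E=\{(x_i)_{i\in I}\in\prod_{i\in I}X_i:(\|x_i\|)_{i\in I}\in E\}$ with the norm $\|(x_i)_{i\in I}\|_E=\|(\|x_i\|)_{i\in I}\|_E$; it is a Banach space. *)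

(* Defs.v *)
From HB Require Import structures.
From mathcomp Require Import all_boot all_order all_algebra.
From mathcomp Require Import all_classical all_reals all_analysis.
From mathcomp Require Import ring lra.

Set Implicit Arguments.
Unset Strict Implicit.
Unset Printing Implicit Defensive.

Import Order.TTheory GRing.Theory Num.Theory.
Import numFieldNormedType.Exports.

Local Open Scope classical_set_scope.
Local Open Scope ring_scope.

Section acs_properties.
Variables (R : realType) (X : completeNormedModType R).
Implicit Types (x : X) (xs ys : nat -> X).

Definition unit_sphere : set X := [set x | `|x| = 1].

Definition dual_norm (f : {linear X -> R^o}) : R :=
  sup [set `|f x| | x in [set x : X | `|x| <= 1]].

(* Continuity is required separately: [sup] is a junk value on unbounded
   sets. *)
Definition dual_unit_sphere : set {linear X -> R^o} :=
  [set f : {linear X -> R^o} | continuous f /\ dual_norm f = 1].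

Definition luacs : Prop := forall x xs (f : {linear X -> R^o}),
  unit_sphere x -> (forall n, unit_sphere (xs n)) -> dual_unit_sphere f ->
  `|xs n + x| @[n --> \oo] --> (2 : R) ->
  f (xs n) @[n --> \oo] --> (1 : R) ->
  f x = 1.

Definition sluacs : Prop :=
  forall x xs (fs : nat -> {linear X -> R^o}),
  unit_sphere x -> (forall n, unit_sphere (xs n)) ->
  (forall n, dual_unit_sphere (fs n)) ->
  `|xs n + x| @[n --> \oo] --> (2 : R) ->
  fs n (xs n) @[n --> \oo] --> (1 : R) ->
  fs n x @[n --> \oo] --> (1 : R).

Definition mluacs : Prop := forall xs ys x (f : {linear X -> R^o}),
  (forall n, unit_sphere (xs n)) -> (forall n, unit_sphere (ys n)) ->
  unit_sphere x -> dual_unit_sphere f ->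
  `|x - 2^-1 *: (xs n + ys n)| @[n --> \oo] --> (0 : R) ->
  f (xs n) @[n --> \oo] --> (1 : R) ->
  f (ys n) @[n --> \oo] --> (1 : R).

Definition msluacs : Prop :=
  forall xs ys x (fs : nat -> {linear X -> R^o}),
  (forall n, unit_sphere (xs n)) -> (forall n, unit_sphere (ys n)) ->
  unit_sphere x -> (forall n, dual_unit_sphere (fs n)) ->
  `|x - 2^-1 *: (xs n + ys n)| @[n --> \oo] --> (0 : R) ->
  fs n (xs n) @[n --> \oo] --> (1 : R) ->
  fs n (ys n) @[n --> \oo] --> (1 : R).

End acs_properties.

(* A normed space [E] that is a linear subspace of [I -> R] is given by a
   subspace [ns_sub] of [I -> R] and a norm on the type of its elements;
   [val a] is the underlying function of [a : aspace E]. *)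
Section subspaces_of_functions.
Variables (R : realType) (I : Type).

Definition fspace (S : submodClosed (I -> R)) : Type := {a : I -> R | a \in S}.

HB.instance Definition _ (S : submodClosed (I -> R)) :=
  SubType.copy (fspace S) {a : I -> R | a \in S}.
HB.instance Definition _ (S : submodClosed (I -> R)) :=
  [Choice of fspace S by <:].
HB.instance Definition _ (S : submodClosed (I -> R)) :=
  [SubChoice_isSubLmodule of fspace S by <:].

Record normedSubspace := NormedSubspace {
  ns_sub : submodClosed (I -> R);
  ns_norm : fspace ns_sub -> R;
  ns_normD : forall a b, ns_norm (a + b) <= ns_norm a + ns_norm b;
  ns_normZ : forall (t : R) a, ns_norm (t *: a) = `|t| * ns_norm a;
  ns_norm0_eq0 : forall a, ns_norm a = 0 -> a = 0 }.

Definition nspace (E : normedSubspace) : Type := fspace (ns_sub E).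

HB.instance Definition _ (E : normedSubspace) :=
  GRing.SubLmodule.copy (nspace E) (fspace (ns_sub E)).
HB.instance Definition _ (E : normedSubspace) :=
  @Lmodule_isNormed.Build R (nspace E) (@ns_norm E)
    (@ns_normD E) (@ns_normZ E) (@ns_norm0_eq0 E).

Definition absolute_norm (E : normedSubspace) : Prop :=
  forall (a : nspace E) (b : I -> R), (forall i, `|val a i| = `|b i|) ->
  exists2 b' : nspace E, val b' = b & `|b'| = `|a|.

(* This includes that the characteristic function of each point is in [E]. *)
Definition normalised_norm (E : normedSubspace) : Prop :=
  forall i, exists2 e : nspace E, val e = \1_[set i] & `|e| = 1.

Definition complete_norm (E : normedSubspace) : Prop :=
  forall F : set_system (nspace E), ProperFilter F -> cauchy F -> cvg F.

Record absNormedSpace := AbsNormedSpace {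
  abs_ns : normedSubspace;
  abs_complete : complete_norm abs_ns;
  abs_absolute : absolute_norm abs_ns;
  abs_normalised : normalised_norm abs_ns }.

Definition aspace (E : absNormedSpace) : Type := nspace (abs_ns E).

HB.instance Definition _ (E : absNormedSpace) :=
  GRing.SubLmodule.copy (aspace E) (nspace (abs_ns E)).
HB.instance Definition _ (E : absNormedSpace) :=
  NormedModule.copy (aspace E) (nspace (abs_ns E)).
HB.instance Definition _ (E : absNormedSpace) :=
  Uniform_isComplete.Build (aspace E) (@abs_complete E).

Definition property_P (E : absNormedSpace) : Prop :=
  forall (an : nat -> aspace E) (a : aspace E),
  (forall n, unit_sphere (an n)) -> unit_sphere a ->
  `|an n + a| @[n --> \oo] --> (2 : R) ->
  forall i, val (an n) i @[n --> \oo] --> (val a i : R).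

Definition span_units (E : absNormedSpace) : set (aspace E) :=
  [set a : aspace E | exists (s : seq I) (c : I -> R),
    val a = \sum_(i <- s) c i *: \1_[set i]].

End subspaces_of_functions.


Section solidity.
Variables (R : realType) (I : Type) (E : absNormedSpace R I).
Implicit Types (a b c : aspace E) (i : I).

Lemma aspace_abs a (b : I -> R) : (forall i, `|val a i| = `|b i|) ->
  exists2 b' : aspace E, val b' = b & `|b'| = `|a|.
Proof. exact: abs_absolute. Qed.

Lemma aspace_unit i : exists2 e : aspace E, val e = \1_[set i] & `|e| = 1.
Proof. exact: abs_normalised. Qed.

Lemma val_coordD a b i : val (a + b) i = val a i + val b i.
Proof. by []. Qed.

Lemma val_coordB a b i : val (a - b) i = val a i - val b i.
Proof. by []. Qed.

Lemma val_coordZ (t : R) a i : val (t *: a) i = t * val a i.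
Proof. by []. Qed.

Lemma le_coord_norm a i : `|val a i| <= `|a|.
Proof.
have [e ei e1] := aspace_unit i.
have [b bE bn] : exists2 b : aspace E,
    val b = (fun j => if `[< j = i >] then val a j else - val a j) &
    `|b| = `|a|.
  by apply: aspace_abs => j; case: asboolP => // _; rewrite normrN.
have abE : a + b = (2 * val a i) *: e.
  apply: val_inj; apply/funext => j.
  rewrite val_coordD val_coordZ bE ei indicE.
  case: asboolP => [->|ji].
    by rewrite mem_set //= mulr1 mulr2n mulrDl mul1r.
  by rewrite memNset ?mulr0 ?subrr.
have := ler_normD a b; rewrite abE normrZ e1 mulr1 normrM bn gtr0_norm//; lra.
Qed.

Lemma cvg_coord (F : set_system (aspace E)) {FF : Filter F} (a : aspace E) i :
  F --> a -> val b i @[b --> F] --> (val a i : R).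
Proof.
move=> Fa; apply/cvgrPdist_le => /= e e0.
move/cvgrPdist_le : Fa => /(_ _ e0).
apply: filterS => b; apply: le_trans; rewrite -val_coordB.
exact: le_coord_norm.
Qed.

Let sgn (t : R) : R := if 0 <= t then 1 else - 1.

Let normr_sgn t : `|sgn t| = 1.
Proof. by rewrite /sgn; case: ifP; rewrite ?normrN normr1. Qed.

(* Binary expansion of a real in [[-1, 1]] with digits 1 and -1. *)
Let dyad (t : R) : nat -> R :=
  fix s n := if n is m.+1 then s m + (2^-1) ^+ m.+1 * sgn (t - s m) else 0.

Let dyad_dist t n : `|t| <= 1 -> `|t - dyad t n| <= (2^-1) ^+ n.
Proof.
move=> t1; elim: n => [|n IH] /=; first by rewrite subr0 expr0.
move: IH; set d := dyad t n; rewrite exprS => IH.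
have p0 : 0 <= (2^-1 : R) ^+ n by rewrite exprn_ge0.
move: IH; rewrite /sgn; set p := _ ^+ n in p0 *; rewrite !ler_norml.
by case: ifP => [|/negbT]; rewrite -?ltNge; lra.
Qed.

(* Completeness of the norm is needed here when [I] is infinite: [b] is the
   sum of a series of sign changes of dyadic multiples of [a]. *)
Lemma aspace_solid a (b : I -> R) : (forall i, `|b i| <= `|val a i|) ->
  exists2 b' : aspace E, val b' = b & `|b'| <= `|a|.
Proof.
move=> ba; pose t i := b i / val a i.
have tb i : t i * val a i = b i.
  have := ba i; rewrite /t; have [->|ai0 _] := eqVneq (val a i) 0.
    by rewrite normr0 normr_le0 mulr0 => /eqP.
  by rewrite mulfVK.
have t1 i : `|t i| <= 1.
  rewrite /t; have [->|ai0] := eqVneq (val a i) 0.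
    by rewrite invr0 mulr0 normr0.
  by rewrite normrM normfV ler_pdivrMr ?normr_gt0// mul1r.
pose v n i := sgn (t i - dyad (t i) n) * val a i.
have /choice[w wP] n : exists w : aspace E, val w = v n /\ `|w| = `|a|.
  have [|w wE wn] := @aspace_abs a (v n); last by exists w.
  by move=> i; rewrite /v normrM normr_sgn mul1r.
pose u n : aspace E := (2^-1) ^+ n.+1 *: w n.
have uE n i : val (series u n) i = dyad (t i) n * val a i.
  elim: n => [|n IH]; first by rewrite /series/= big_geq// mul0r.
  by rewrite seriesSr val_coordD IH /u val_coordZ (wP n).1 /v mulrDl !mulrA.
have un n : `|u n| = geometric (2^-1 * `|a|) 2^-1 n.
  rewrite /u normrZ (wP n).2 normrX ger0_norm ?invr_ge0// /geometric/= exprS.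
  by rewrite mulrAC.
have half1 : `|2^-1 : R| < 1 by rewrite ger0_norm ?invr_ge0// invf_lt1// ltr1n.
have cu : cvgn (series u).
  apply: normed_cvg.
  suff -> : [normed series u] = series (geometric (2^-1 * `|a|) 2^-1).
    exact: is_cvg_geometric_series.
  by congr series; exact/funext.
exists (lim (series u @ \oo)).
  apply/funext => i.
  have h1 : val (series u n) i @[n --> \oo] --> val (limn (series u)) i.
    exact: cvg_coord cu.
  suff h2 : val (series u n) i @[n --> \oo] --> b i
    by exact: (cvg_unique _ h1 h2).
  rewrite -[X in _ --> X]tb; under eq_fun do rewrite uE.
  apply: cvgMl; apply/cvgrPdist_le => /= e e0.
  have /cvgrPdist_le/(_ e e0) := cvg_expr half1.
  apply: filterS => n; apply: le_trans.
  by rewrite sub0r normrN (le_trans (dyad_dist _ (t1 i)))// ler_norm.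
have h : `|series u n| @[n --> \oo] --> `|lim (series u @ \oo)|.
  exact: cvg_norm cu.
rewrite -(cvg_lim (@Rhausdorff R) h).
have un' m : `|series u m| <= (1 - (2^-1) ^+ m) * `|a|.
  elim: m => [|m IH].
    by rewrite /series/= big_geq// normr0 expr0 subrr mul0r.
  rewrite seriesSr; apply: (le_trans (ler_normD _ _)); rewrite un /geometric /=.
  by have := normr_ge0 a; move: IH; rewrite exprS; set p := _ ^+ m; lra.
apply: (limr_le (cvgP _ h)); apply: nearW => n; apply: (le_trans (un' n)).
by rewrite ler_piMl// gerBl exprn_ge0// invr_ge0.
Qed.

End solidity.

Section product_module.
Variables (R : realType) (I : Type) (X : I -> completeNormedModType R).

Definition famprod : Type := forall i, X i.

HB.instance Definition _ := Choice.copy famprod (forall i, X i).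

Implicit Types x y z : famprod.

Let addfA : associative (fun x y : famprod => (fun i => x i + y i) : famprod).
Proof.
by move=> x y z; apply: functional_extensionality_dep => i; rewrite addrA.
Qed.

Let addfC : commutative (fun x y : famprod => (fun i => x i + y i) : famprod).
Proof.
by move=> x y; apply: functional_extensionality_dep => i; rewrite addrC.
Qed.

Let add0f : left_id ((fun i => 0) : famprod)
  (fun x y : famprod => (fun i => x i + y i) : famprod).
Proof.
by move=> x; apply: functional_extensionality_dep => i; rewrite add0r.
Qed.

Let addNf : left_inverse ((fun i => 0) : famprod)
  (fun x : famprod => (fun i => - x i) : famprod)
  (fun x y : famprod => (fun i => x i + y i) : famprod).
Proof.
by move=> x; apply: functional_extensionality_dep => i; rewrite addNr.
Qed.

HB.instance Definition _ :=
  GRing.isZmodule.Build famprod addfA addfC add0f addNf.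

Let scalefA (s t : R) x :
  (fun i => s *: (t *: x i)) = (fun i => (s * t) *: x i).
Proof. by apply: functional_extensionality_dep => i; rewrite scalerA. Qed.

Let scale1f x : (fun i => 1 *: x i) = x.
Proof. by apply: functional_extensionality_dep => i; rewrite scale1r. Qed.

Let scalefDr (t : R) x y :
  (fun i => t *: (x i + y i)) = (fun i => t *: x i + t *: y i).
Proof. by apply: functional_extensionality_dep => i; rewrite scalerDr. Qed.

Let scalefDl x (s t : R) :
  (fun i => (s + t) *: x i) = (fun i => s *: x i + t *: x i).
Proof. by apply: functional_extensionality_dep => i; rewrite scalerDl. Qed.

HB.instance Definition _ := GRing.Zmodule_isLmodule.Build R famprod
  (scale := fun t x i => t *: x i)
  scalefA scale1f scalefDr scalefDl.

End product_module.

Section absolute_sum.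
Variables (R : realType) (I : Type) (E : absNormedSpace R I).
Variable X : I -> completeNormedModType R.
Implicit Types (x y z : famprod X) (i : I).

Definition norms x : I -> R := fun i => `|x i|.

Definition asum_pred : {pred famprod X} :=
  [pred x | norms x \in ns_sub (abs_ns E)].

Let solid_mem (a b : I -> R) : a \in ns_sub (abs_ns E) ->
  (forall i, `|b i| <= `|a i|) -> b \in ns_sub (abs_ns E).
Proof.
move=> aE /(@aspace_solid _ _ E (exist _ a aE))[b' <- _]; exact: valP b'.
Qed.

(* Closure under addition rests on [aspace_solid], since [norms (x + y)] is
   only dominated by [norms x + norms y]. *)
Lemma asum_submod_closed : submod_closed asum_pred.
Proof.
split=> [|t x y].
  rewrite inE (_ : norms 0 = 0) ?rpred0//; apply/funext => i.
  by rewrite /norms normr0.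
rewrite !inE => xE yE.
have txy : `|t| *: norms x + norms y \in ns_sub (abs_ns E).
  by rewrite rpredD// rpredZ.
apply: (solid_mem txy) => i; rewrite /norms normr_id ger0_norm; last first.
  by rewrite addr_ge0// mulr_ge0.
by rewrite (le_trans (ler_normD _ _))// normrZ.
Qed.

HB.instance Definition _ := GRing.isSubmodClosed.Build R (famprod X) asum_pred
  asum_submod_closed.

Definition asum : Type := {x : famprod X | x \in asum_pred}.

HB.instance Definition _ := SubType.copy asum {x : famprod X | x \in asum_pred}.
HB.instance Definition _ := [Choice of asum by <:].
HB.instance Definition _ := [SubChoice_isSubLmodule of asum by <:].

Definition asum_norms (u : asum) : aspace E := exist _ (norms (val u)) (valP u).

Definition asum_norm (u : asum) : R := `|asum_norms u|.

Let solid_norm (a b : aspace E) : (forall i, `|val a i| <= `|val b i|) ->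
  `|a| <= `|b|.
Proof. by move=> /aspace_solid[a' /val_inj ->]. Qed.

Let asum_normD (u v : asum) : asum_norm (u + v) <= asum_norm u + asum_norm v.
Proof.
apply: (le_trans _ (ler_normD _ _)); apply: solid_norm => i.
rewrite /= /norms normr_id ger0_norm ?addr_ge0//; exact: ler_normD.
Qed.

Let asum_normZ (t : R) (u : asum) : asum_norm (t *: u) = `|t| * asum_norm u.
Proof.
rewrite /asum_norm -[in RHS](normr_id t) -normrZ; congr `|_|.
by apply: val_inj; apply/funext => i; rewrite /= /norms normrZ.
Qed.

Let asum_norm0_eq0 (u : asum) : asum_norm u = 0 -> u = 0.
Proof.
move=> /normr0_eq0 /(congr1 val) u0; apply: val_inj.
apply: functional_extensionality_dep => i.
by apply: normr0_eq0; have := congr1 (fun a => a i) u0.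
Qed.

HB.instance Definition _ :=
  Lmodule_isNormed.Build R asum asum_normD asum_normZ asum_norm0_eq0.

Lemma asum_normE (u : asum) : `|u| = `|asum_norms u|.
Proof. by []. Qed.

Let lipschitz1_cauchy (V W : normedModType R) (f : V -> W) (F : set_system V) :
  ProperFilter F -> (forall v w, `|f v - f w| <= `|v - w|) ->
  cauchy F -> cauchy (f @ F).
Proof.
move=> FF fl /cauchyP Fc; apply/cauchyP => e e0.
have [v Fv] := Fc e e0; exists (f v).
move: Fv; rewrite -!ball_normE; apply: (@filterS _ F) => w /=.
exact: le_lt_trans.
Qed.

Let coord_asum_norm i (u : asum) : `|val u i| <= `|u|.
Proof.
by apply: le_trans (le_coord_norm (asum_norms u) i); rewrite /= normr_id.
Qed.

Lemma asum_complete (F : set_system asum) : ProperFilter F -> cauchy F -> cvg F.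
Proof.
move=> FF Fc.
pose l i := lim (val v i @[v --> F]).
have lP i : val v i @[v --> F] --> l i.
  apply: cauchy_cvg; apply: lipschitz1_cauchy Fc => v w.
  exact: (coord_asum_norm i (v - w)).
have dist u : exists2 d : aspace E, asum_norms (u - v) @[v --> F] --> d &
    val d = norms (val u - (l : famprod X)).
  have cd : cvg (asum_norms (u - v) @[v --> F]).
    apply: cauchy_cvg; apply: lipschitz1_cauchy Fc => v w.
    apply: solid_norm => i; rewrite /= /norms normr_id.
    rewrite [leRHS]distrC.
    rewrite (_ : val w i - val v i = (val u i - val v i) - (val u i - val w i)).
      exact: ler_dist_dist.
    by rewrite opprB [RHS]addrC subrKA.
  exists (lim (asum_norms (u - v) @[v --> F])) => //.
  apply/funext => i.
  have h1 : val (asum_norms (u - v)) i @[v --> F] -->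
      val (lim (asum_norms (u - v) @[v --> F])) i by exact: cvg_coord cd.
  suff h2 : val (asum_norms (u - v)) i @[v --> F] -->
      norms (val u - (l : famprod X)) i by exact: (cvg_unique _ h1 h2).
  by apply: cvg_norm; apply: cvgB (lP i); exact: cvg_cst.
have lE : (l : famprod X) \in asum_pred.
  have [d _ dE] := dist 0.
  rewrite inE (_ : norms l = val d); first exact: valP d.
  by rewrite dE; apply/funext => i; rewrite /norms sub0r normrN.
pose L : asum := exist _ (l : famprod X) lE.
apply/cvg_ex; exists L; apply/cvgrPdist_le => e e0.
have /cauchyP /(_ (e / 2)) [|u Fu] := Fc; first by rewrite divr_gt0.
have [d ud dE] := dist u.
have uL : `|u - L| <= e / 2.
  have -> : `|u - L| = `|d|.
    by rewrite asum_normE; congr Num.norm; apply: val_inj; rewrite dE.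
  have h : `|asum_norms (u - v)| @[v --> F] --> `|d| by exact: cvg_norm.
  rewrite -(cvg_lim (@Rhausdorff R) h); apply: (limr_le (cvgP _ h)).
  by apply: filterS Fu => v; rewrite -ball_normE => /ltW.
apply: filterS Fu => v; rewrite -ball_normE /ball_/= => uv.
rewrite -(subrKA u) (le_trans (ler_normD _ _))// distrC [leRHS](splitr e).
by rewrite lerD// ltW.
Qed.

HB.instance Definition _ := Uniform_isComplete.Build asum asum_complete.

End absolute_sum.

(* Main.v *)
Require Import Defs.
From HB Require Import structures.
From mathcomp Require Import all_boot all_order all_algebra.
From mathcomp Require Import all_classical all_reals all_analysis.
From mathcomp Require Import ring lra.

Set Implicit Arguments.
Unset Strict Implicit.
Unset Printing Implicit Defensive.

Import Order.TTheory GRing.Theory Num.Theory.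
Import numFieldNormedType.Exports.

Local Open Scope classical_set_scope.
Local Open Scope ring_scope.

(** Write [norms z] for the function sending [i] to the norm of the coordinate
    [z i].  Let [us n], [vs n], [x] be unit vectors of the absolute sum with
    [(us n + vs n) / 2] tending to [x], and let [fs n] be functionals of norm
    one with [fs n (us n)] tending to 1; the goal is that [fs n (vs n)] tends
    to 1.

    Passing to norms.  Since [us n + x] is close to [3 x - vs n], its norm
    tends to 2, hence so does the norm of [norms (us n) + norms x] in [E]; the
    same holds for [vs].  Property (P) then gives convergence of the norms of
    all the coordinates of [us n] and of [vs n] to those of [x].

    Passing to functionals on [E].  Every functional [f] of norm one on the sum
    has a modulus [c], a positive functional of norm one on [E] such that
    [|f z| <= c (norms z)], and the value of [c] at the unit vector [e_i] is
    the norm of the coordinate functional [f_i] ([exists_modulus_functional]).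
    From [fs n (us n) <= cs n (norms (us n)) <= 1] the hypothesis on [E]
    applies to the moduli [cs n] and yields that [cs n (norms x)] tends to 1.

    One coordinate at a time.  The difference of [cs n (norms z)] and
    [fs n z] is a sum of nonnegative contributions of the coordinates.  For
    [z = us n] the total tends to 0, so each coordinate functional almost
    attains its norm at [us n i]; the hypothesis on [X i], applied to the
    normalised coordinates, transfers this to [vs n i]
    ([near_coord_functional]).  The only delicate point is the normalisation:
    coordinates and coordinate functionals may vanish or tend to 0, which is
    why the hypothesis is first put into the homogeneous epsilon-delta form
    [midpoint_acs_homogeneous].

    Summing up.  By density of the finitely supported functions, a finite set
    of coordinates carries [norms x] up to a small error.  On the restriction
    of [vs n] to these coordinates, [fs n] almost agrees with [cs n], whose
    value there is almost 1 by coordinatewise convergence.  As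
    [cs n (norms (vs n)) <= 1], the remaining coordinates of [vs n] contribute
    almost nothing ([cvg_functional_midpoint]).

    The two halves of the theorem differ only in the functionals allowed: all
    those of norm one, or a single one.  The argument is therefore carried out
    for an arbitrary set of functionals. *)

(** * Functionals of norm one *)

Lemma cvg_from_below (R : realType) (g : nat -> R) (l : R) :
  (forall n, g n <= l) ->
  (forall e, 0 < e -> \forall n \near \oo, l - e <= g n) ->
  g n @[n --> \oo] --> l.
Proof.
move=> gl gt; apply/cvgrPdist_le => /= e e0; apply: filterS (gt e e0) => n.
by rewrite ger0_norm ?subr_ge0// lerBlDr addrC -lerBlDr.
Qed.

Section functionals.
Variables (R : realType) (X : completeNormedModType R).
Implicit Types (f : {linear X -> R^o}) (x u v : X) (r e : R).

Lemma bounded_functional_continuous f r :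
  (forall x, `|f x| <= r * `|x|) -> continuous f.
Proof.
move=> fr; apply: bounded_linear_continuous; apply/linear_boundedP.
exists r; split=> [|s rs x]; first exact: num_real.
by rewrite (le_trans (fr x))// ler_wpM2r// ltW.
Qed.

Lemma dual_norm_le f r : (forall x, `|x| <= 1 -> `|f x| <= r) ->
  dual_norm f <= r.
Proof.
move=> fr; apply: ge_sup => [|_ [x /= x1 <-]]; last exact: fr.
by exists `|f 0|, 0 => //=; rewrite normr0.
Qed.

Lemma le_dual_norm_ball f r x : (forall x, `|f x| <= r * `|x|) -> `|x| <= 1 ->
  `|f x| <= dual_norm f.
Proof.
move=> fr x1; apply: ub_le_sup; last by exists x.
exists `|r| => _ [y /= y1 <-]; apply: (le_trans (fr y)).
apply: (le_trans (ler_norm _)); rewrite normrM normr_id.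
by rewrite ler_piMr.
Qed.

Lemma le_dual_norm f r x : (forall x, `|f x| <= r * `|x|) ->
  `|f x| <= dual_norm f * `|x|.
Proof.
move=> fr; have [->|x0] := eqVneq x 0.
  by rewrite linear0 !normr0 mulr0.
have nx0 : 0 < `|x| by rewrite normr_gt0.
have := @le_dual_norm_ball f r (`|x|^-1 *: x) fr.
rewrite linearZ/= !normrZ normfV normr_id mulVf ?gt_eqF// => /(_ (lexx _)).
by rewrite ler_pdivrMl// mulrC.
Qed.

Lemma dual_unit_sphere_le f x : dual_unit_sphere f -> `|f x| <= `|x|.
Proof.
move=> [fc f1].
have [r [_ fr]] := (linear_boundedP f).1 (continuous_linear_bounded 0 (fc 0)).
by rewrite -[leRHS]mul1r -f1; apply: (@le_dual_norm f (r + 1)); apply: fr;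
  rewrite ltrDl.
Qed.

Lemma dual_unit_sphere_le1 f x : dual_unit_sphere f -> unit_sphere x ->
  f x <= 1.
Proof.
move=> f1 x1; apply: (le_trans (ler_norm _)).
by apply: (le_trans (dual_unit_sphere_le x f1)); rewrite x1.
Qed.

Lemma normalised_functional f r : (forall x, `|f x| <= r * `|x|) ->
  dual_norm f != 0 -> dual_unit_sphere ((dual_norm f)^-1 \*: f).
Proof.
move=> fr f0; set k := dual_norm f.
have k0 : 0 < k.
  rewrite lt_def f0/= (le_trans _ (le_dual_norm_ball (x := 0) fr _)) ?normr0//.
have gE x : `|(k^-1 \*: f) x| = k^-1 * `|f x|.
  by rewrite /= normrZ ger0_norm// invr_ge0 ltW.
have gle x : `|(k^-1 \*: f) x| <= 1 * `|x|.
  by rewrite gE mul1r ler_pdivrMl// (le_dual_norm _ fr).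
split; first exact: bounded_functional_continuous gle.
apply/eqP; rewrite eq_le; apply/andP; split.
  by apply: dual_norm_le => x x1; rewrite (le_trans (gle x))// mul1r.
rewrite -(ler_pM2l k0) mulr1; apply: (@dual_norm_le f) => x x1.
by rewrite -ler_pdivrMl// -gE; apply: le_dual_norm_ball gle _.
Qed.

(** The common form of the two midpoint properties at the point [x]: the set
    [F] is the whole dual sphere for msluacs and a singleton for mluacs. *)
Definition midpoint_acs (F : set {linear X -> R^o}) x :=
  forall (us vs : nat -> X) (fs : nat -> {linear X -> R^o}),
  (forall n, unit_sphere (us n)) -> (forall n, unit_sphere (vs n)) ->
  (forall n, F (fs n)) ->
  `|x - 2^-1 *: (us n + vs n)| @[n --> \oo] --> (0 : R) ->
  fs n (us n) @[n --> \oo] --> (1 : R) ->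
  fs n (vs n) @[n --> \oo] --> (1 : R).

(** A failure for every [d = 1 / (n + 1)] would give sequences violating
    [midpoint_acs].  The epsilon-delta form can be used at those [n] only where
    the vectors and functionals to be normalised are nonzero, which the
    sequential form does not allow. *)
Lemma midpoint_acs_uniform F x e :
  midpoint_acs F x -> F `<=` @dual_unit_sphere R X -> 0 < e ->
  exists2 d : R, 0 < d & forall u v f,
    unit_sphere u -> unit_sphere v -> F f ->
    `|x - 2^-1 *: (u + v)| <= d -> 1 - d <= f u -> 1 - e <= f v.
Proof.
move=> FP F1 e0; apply: contrapT => nd.
have H (n : nat) : exists t : X * X * {linear X -> R^o},
    [/\ unit_sphere t.1.1, unit_sphere t.1.2, F t.2,
      `|x - 2^-1 *: (t.1.1 + t.1.2)| <= n.+1%:R^-1 &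
      1 - n.+1%:R^-1 <= t.2 t.1.1 /\ t.2 t.1.2 < 1 - e].
  apply: contrapT => nt; apply: nd; exists n.+1%:R^-1.
    by rewrite invr_gt0.
  move=> u v f u1 v1 Ff le1 le2; rewrite leNgt; apply/negP => lt3.
  by apply: nt; exists (u, v, f).
have {H}/choice[t tP] := H.
have inv0 : (n.+1%:R^-1 : R) @[n --> \oo] --> (0 : R) by exact: cvg_harmonic.
have c1 : (t n).2 (t n).1.2 @[n --> \oo] --> (1 : R).
  apply: (FP (fun n => (t n).1.1) (fun n => (t n).1.2) (fun n => (t n).2)).
  - by move=> n; case: (tP n).
  - by move=> n; case: (tP n).
  - by move=> n; case: (tP n).
  - apply: (squeeze_cvgr _ (cvg_cst 0) inv0); apply: nearW => n.
    by rewrite normr_ge0; case: (tP n).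
  - apply: cvg_from_below => [n|d d0].
      case: (tP n) => u1 _ /F1 Fn _ _.
      exact: dual_unit_sphere_le1.
    near=> n; case: (tP n) => _ _ _ _ [+ _]; apply: le_trans.
    by rewrite lerB// ltW//; near: n; exact: near_infty_natSinv_lt (PosNum d0).
have /cvgrPdist_lt/(_ _ e0)[N _ /(_ N (leqnn N))] := c1.
by rewrite ltr_norml => /andP[_]; case: (tP N) => _ _ _ _ [_]; lra.
Unshelve. all: by end_near. Qed.

Lemma msluacs_midpoint_acs x : msluacs X -> unit_sphere x ->
  midpoint_acs (@dual_unit_sphere R X) x.
Proof. by move=> XP x1 us vs fs u1 v1 f1; exact: XP. Qed.

Lemma mluacs_midpoint_acs x f : mluacs X -> unit_sphere x ->
  dual_unit_sphere f -> midpoint_acs [set f] x.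
Proof.
move=> XP x1 f1 us vs fs u1 v1 fE.
have -> : fs = (fun=> f) by exact/funext.
exact: XP.
Qed.

Lemma sub_midpoint_acs (F G : set {linear X -> R^o}) x : F `<=` G ->
  midpoint_acs G x -> midpoint_acs F x.
Proof. by move=> FG GP us vs fs u1 v1 /(_ _)/FG; exact: GP. Qed.

Definition normalisations (F : set {linear X -> R^o}) : set {linear X -> R^o} :=
  [set g | exists f, [/\ F f, dual_norm f != 0 &
    g = (dual_norm f)^-1 \*: f :> {linear X -> R^o}]].

Lemma normalisations_sub (F : set {linear X -> R^o}) r :
  (forall f x, F f -> `|f x| <= r * `|x|) ->
  normalisations F `<=` @dual_unit_sphere R X.
Proof.
move=> Fr _ [f [Ff f0 ->]].
by apply: (@normalised_functional f r) => // x; exact: Fr.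
Qed.

Lemma polar_decomposition x : x != 0 ->
  exists2 u, unit_sphere u & x = `|x| *: u.
Proof.
rewrite -normr_eq0 => x0; exists (`|x|^-1 *: x); last by rewrite scalerKV.
by rewrite /unit_sphere /= normrZ normfV normr_id mulVf.
Qed.

(** The version of [midpoint_acs] without normalisation.  If the product of
    [dual_norm f] and [`|v|] is at most [e / 2] there is nothing to prove, as
    [f v] is at least minus that product.  Otherwise [dual_norm f] is bounded
    below, [u] and [v] have norm close to that of [x], and dividing by these
    quantities changes the errors by bounded factors only. *)
Lemma midpoint_acs_homogeneous (F : set {linear X -> R^o}) x e :
  (forall f x, F f -> `|f x| <= `|x|) ->
  (x != 0 -> midpoint_acs (normalisations F) (`|x|^-1 *: x)) -> 0 < e ->
  exists2 d : R, 0 < d & forall u v f, F f ->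
    `| `|u| - `|x| | <= d -> `| `|v| - `|x| | <= d ->
    `|x - 2^-1 *: (u + v)| <= d -> dual_norm f * `|u| - d <= f u ->
    dual_norm f * `|v| - e <= f v.
Proof.
move=> F1 FP e0.
have F1' f z : F f -> `|f z| <= 1 * `|z| by move=> /F1; rewrite mul1r.
have le_k f z : F f -> `|f z| <= dual_norm f * `|z|.
  by move=> Ff; apply: (@le_dual_norm f 1) => y; exact: F1'.
have k0 f : F f -> 0 <= dual_norm f.
  move=> Ff; apply: le_trans (le_dual_norm_ball (x := 0) _ _); last 2 first.
  - by move=> y; exact: F1' Ff.
  - by rewrite normr0.
  exact: normr_ge0.
have k1 f : F f -> dual_norm f <= 1.
  by move=> Ff; apply: dual_norm_le => y y1; rewrite (le_trans (F1 _ _ Ff)).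
have small f v : F f -> 2 * (dual_norm f * `|v|) <= e ->
    dual_norm f * `|v| - e <= f v.
  by move=> Ff; have := le_k f v Ff; rewrite ler_norml => /andP[]; lra.
have [x0|x0] := eqVneq x 0.
  exists (e / 2) => [|u v f Ff _]; first by rewrite divr_gt0.
  rewrite x0 normr0 subr0 normr_id => ve _ _; apply: small => //.
  have := ler_pM (k0 _ Ff) (normr_ge0 v) (k1 _ Ff) ve; lra.
have [x' x'1 xE] := polar_decomposition x0.
have := FP x0; rewrite [X in midpoint_acs _ (_ *: X)]xE.
rewrite scalerK ?normr_eq0// => {}FP.
move: x0 xE; rewrite -normr_gt0; set a := `|x| => a0 xE.
have e'0 : 0 < e / (2 * a) by rewrite divr_gt0// mulr_gt0.
have [d d0 dP] := midpoint_acs_uniform FP (normalisations_sub F1') e'0.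
(* [a / 2] keeps [u] and [v] away from 0; [d * (e / 8)] is the error allowed
   for [f u], as [dual_norm f * `|u|] will be at least [e / 8]; [d * (a / 2)]
   is the error allowed for the midpoint, which normalisation at most doubles
   before the division by [a]. *)
exists (Num.min (a / 2) (Num.min (d * (e / 8)) (d * (a / 2)))).
  by rewrite !lt_min divr_gt0// !mulr_gt0// divr_gt0.
move=> u v f Ff; set h := Num.min _ _.
have [h1 h2 h3] : [/\ h <= a / 2, h <= d * (e / 8) & h <= d * (a / 2)].
  by split; rewrite /h !ge_min lexx ?orbT.
move: h h1 h2 h3 => h h1 h2 h3 ua va mid fu.
have [|big] := leP (2 * (dual_norm f * `|v|)) e; first exact: small.
have ua0 : a / 2 <= `|u| by move: ua; rewrite ler_norml => /andP[]; lra.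
have va0 : a / 2 <= `|v| by move: va; rewrite ler_norml => /andP[]; lra.
have va1 : `|v| <= 2 * a by move: va; rewrite ler_norml => /andP[]; lra.
have u0 : 0 < `|u| by lra.
have v0 : 0 < `|v| by lra.
have kpos : 0 < dual_norm f.
  rewrite lt_def k0// andbT; apply: contraTneq big => ->.
  by rewrite -leNgt; lra.
have [|u' u'1 uE] := @polar_decomposition u; first by rewrite -normr_gt0.
have [|v' v'1 vE] := @polar_decomposition v; first by rewrite -normr_gt0.
have fuE : f u = `|u| * f u' by rewrite {1}uE linearZ.
have fvE : f v = `|v| * f v' by rewrite {1}vE linearZ.
have mid' : `|x' - 2^-1 *: (u' + v')| <= d.
  rewrite -(ler_pM2l a0) -[X in X * _](ger0_norm (ltW a0)) -normrZ.
  have -> : a *: (x' - 2^-1 *: (u' + v')) = (x - 2^-1 *: (u + v)) +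
      2^-1 *: ((`|u| - a) *: u' + (`|v| - a) *: v').
    rewrite !scalerBl -uE -vE scalerBr -xE -addrA; congr (_ + _).
    rewrite scalerA mulrC -scalerA -!scalerN -scalerDr; congr (_ *: _).
    by rewrite addrACA addKr -scalerDr opprD.
  apply: (le_trans (ler_normD _ _)); rewrite [X in _ + X]normrZ ger0_norm//.
  have := ler_normD ((`|u| - a) *: u') ((`|v| - a) *: v').
  by rewrite !normrZ u'1 v'1 !mulr1; lra.
pose g : {linear X -> R^o} := (dual_norm f)^-1 \*: f.
have := dP u' v' g u'1 v'1 _ mid'.
have gE w : g w = (dual_norm f)^-1 * f w by [].
rewrite !gE => dP'.
have {dP'} : 1 - e / (2 * a) <= (dual_norm f)^-1 * f v'.
  apply: dP'; first by exists f; rewrite gt_eqF.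
  rewrite ler_pdivlMl// -(ler_pM2l u0) -fuE (le_trans _ fu)//.
  have uk : e / 8 <= dual_norm f * `|u|.
    have : dual_norm f * `|v| <= dual_norm f * (4 * `|u|).
      by rewrite ler_wpM2l ?k0//; lra.
    by lra.
  have := ler_wpM2l (ltW d0) uk; lra.
rewrite ler_pdivlMl// -(ler_pM2l v0) -fvE; apply: le_trans.
have : dual_norm f * `|v| * (e / (2 * a)) <= e.
  rewrite mulrA ler_pdivrMr ?mulr_gt0// mulrC ler_pM2l//.
  have := ler_wpM2r (ltW v0) (k1 _ Ff); lra.
by lra.
Qed.

End functionals.

(** * The modulus of a functional on an absolute sum *)

(** With [v] written as a difference [u - w] of elements of the cone, the value
    at [v] has to be [p u - p w], and additivity of [p] makes this independent
    of the decomposition. *)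
Lemma linear_extension_of_cone (R : realType) (V : lmodType R) (P : set V)
    (p : V -> R) :
  (forall u v, P u -> P v -> P (u + v)) ->
  (forall (t : R) u, 0 <= t -> P u -> P (t *: u)) ->
  (forall v, exists u w, [/\ P u, P w & v = u - w]) ->
  (forall u v, P u -> P v -> p (u + v) = p u + p v) ->
  (forall (t : R) u, 0 <= t -> P u -> p (t *: u) = t * p u) ->
  exists c : {linear V -> R^o}, forall u, P u -> c u = p u.
Proof.
move=> PD PZ Pgen pD pZ.
have /choice[d dP] v : exists d : V * V, [/\ P d.1, P d.2 & v = d.1 - d.2].
  by have [u [w [Pu Pw ->]]] := Pgen v; exists (u, w).
pose c v : R^o := p (d v).1 - p (d v).2.
have cE u w : P u -> P w -> c (u - w) = p u - p w.
  move=> Pu Pw; have [P1 P2 /eqP] := dP (u - w).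
  rewrite subr_eq addrAC eq_sym subr_eq => /eqP /(congr1 p).
  by rewrite !pD// /c; lra.
have PDZ (t : R) u v : 0 <= t -> P u -> P v -> P (t *: u + v).
  by move=> t0 Pu Pv; apply: PD => //; exact: PZ.
have c_lin : linear c.
  move=> t v v'; have [Pu Pw vE] := dP v; have [Pu' Pw' vE'] := dP v'.
  have [t0|t0] := leP 0 t.
    have -> : t *: v + v' =
        (t *: (d v).1 + (d v').1) - (t *: (d v).2 + (d v').2).
      by rewrite [in LHS]vE [in LHS]vE' scalerBr opprD addrACA.
    rewrite cE ?pD ?pZ//; try exact: PZ; try exact: PDZ.
    change (t * p (d v).1 + p (d v').1 - (t * p (d v).2 + p (d v').2) =
      t * (p (d v).1 - p (d v).2) + (p (d v').1 - p (d v').2) :> R); lra.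
  (* a negative scalar exchanges the two parts of the decomposition *)
  have t0' : 0 <= - t by lra.
  have -> : t *: v + v' =
      (- t *: (d v).2 + (d v').1) - (- t *: (d v).1 + (d v').2).
    rewrite [in LHS]vE [in LHS]vE' !scaleNr scalerBr opprD opprK.
    by rewrite [RHS]addrACA (addrC (- _)).
  rewrite cE ?pD ?pZ//; try exact: PZ; try exact: PDZ.
  change (- t * p (d v).2 + p (d v').1 - (- t * p (d v).1 + p (d v').2) =
    t * (p (d v).1 - p (d v).2) + (p (d v').1 - p (d v').2) :> R); lra.
pose cL := GRing.isLinear.Build R V R^o *:%R c c_lin.
pose c' : {linear V -> R^o} := HB.pack c cL.
exists c' => u Pu; rewrite -[u in LHS]subr0 -[0](scale0r u).
by rewrite /c'/= cE ?pZ ?mul0r ?subr0//; apply: PZ.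
Qed.

Section absolute_sum.
Variables (R : realType) (I : Type) (E : absNormedSpace R I).
Variable X : I -> completeNormedModType R.
Implicit Types (a b : aspace E) (z : asum E X) (i : I) (A : set I).

Lemma aspace_norm_le a b : (forall i, `|val a i| <= `|val b i|) ->
  `|a| <= `|b|.
Proof. by move=> /aspace_solid[a' /val_inj ->]. Qed.

Lemma aspace_modulus b :
  exists2 b' : aspace E, forall i, val b' i = `|val b i| & `|b'| = `|b|.
Proof.
have [|b' bE bn] := @aspace_abs _ _ E b (fun i => `|val b i|).
  by move=> i; rewrite normr_id.
by exists b' => // i; rewrite bE.
Qed.

Lemma asum_dominated b (x : famprod X) : (forall i, `|x i| <= `|val b i|) ->
  exists z : asum E X, val z = x.
Proof.
move=> xb; have [|b' bE _] := @aspace_solid _ _ E b (norms x).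
  by move=> i; rewrite /norms normr_id.
have xE : x \in @asum_pred R I E X by rewrite inE -bE; exact: (valP b').
by exists (exist _ x xE).
Qed.

Lemma asum_eq z z' : (forall i, val z i = val z' i) -> z = z'.
Proof.
by move=> zz'; apply: val_inj; apply: functional_extensionality_dep.
Qed.

Lemma asum_norms_eq z b : (forall i, `|val z i| = val b i) -> asum_norms z = b.
Proof. by move=> zb; apply: val_inj; apply/funext. Qed.

Lemma asum_coordD z z' i : val (z + z') i = val z i + val z' i.
Proof. by []. Qed.

Lemma asum_coordB z z' i : val (z - z') i = val z i - val z' i.
Proof. by []. Qed.

Lemma asum_coordZ (t : R) z i : val (t *: z) i = t *: val z i.
Proof. by []. Qed.

Definition unit_vec i : aspace E := sval (cid2 (aspace_unit E i)).

Lemma unit_vecE i : val (unit_vec i) = \1_[set i].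
Proof. by rewrite /unit_vec; case: cid2. Qed.

Lemma unit_vec_norm i : `|unit_vec i| = 1.
Proof. by rewrite /unit_vec; case: cid2. Qed.

Lemma unit_vec_ge0 i j : 0 <= val (unit_vec i) j.
Proof. by rewrite unit_vecE indicE. Qed.

(** The equality test is classical and the transport is along a proof of
    [i = j] because [X] is a dependent family. *)
Definition single_fam i (x : X i) : famprod X := fun j =>
  match pselect (i = j) with
  | left ij => eq_rect i (fun j => X j : Type) x j ij
  | right _ => 0
  end.

Lemma single_fam_id i (x : X i) : single_fam x i = x.
Proof.
rewrite /single_fam; case: pselect => // ii.
by rewrite (Prop_irrelevance ii erefl).
Qed.

Lemma single_fam_neq i j (x : X i) : i <> j -> single_fam x j = 0.
Proof. by rewrite /single_fam; case: pselect. Qed.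

Lemma norm_single_fam i (x : X i) j :
  `|single_fam x j| = val (`|x| *: unit_vec i) j.
Proof.
rewrite val_coordZ unit_vecE indicE; have [<-|ij] := pselect (i = j).
  by rewrite single_fam_id mem_set// mulr1.
by rewrite single_fam_neq// normr0 memNset ?mulr0// => /= ji; exact: ij.
Qed.

Lemma single_fam_in i (x : X i) : single_fam x \in @asum_pred R I E X.
Proof.
rewrite inE (_ : norms _ = val (`|x| *: unit_vec i)); first exact: valP.
by apply/funext => j; rewrite /norms norm_single_fam.
Qed.

Definition single i (x : X i) : asum E X :=
  exist _ (single_fam x) (single_fam_in x).

Lemma single_id i (x : X i) : val (single x) i = x.
Proof. exact: single_fam_id. Qed.

Lemma single_neq i j (x : X i) : i <> j -> val (single x) j = 0.
Proof. exact: single_fam_neq. Qed.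

Lemma asum_norms_single i (x : X i) :
  asum_norms (single x) = `|x| *: unit_vec i.
Proof. by apply: asum_norms_eq => j; rewrite norm_single_fam. Qed.

Lemma norm_single i (x : X i) : `|single x| = `|x|.
Proof.
by rewrite asum_normE asum_norms_single normrZ normr_id unit_vec_norm mulr1.
Qed.

Lemma single_linear i : linear (@single i).
Proof.
move=> t x y; apply: asum_eq => j; have [<-|ij] := pselect (i = j).
  by rewrite asum_coordD asum_coordZ !single_id.
by rewrite asum_coordD asum_coordZ !single_neq// scaler0 addr0.
Qed.

HB.instance Definition _ i := GRing.isLinear.Build R (X i) (asum E X) *:%R
  (@single i) (@single_linear i).

Definition coord_functional (f : {linear asum E X -> R^o}) i :
  {linear X i -> R^o} := f \o @single i.

Section modulus.
Variable f : {linear asum E X -> R^o}.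
Hypothesis f_le : forall z, `|f z| <= `|z|.

Definition nonneg : set (aspace E) := [set b | forall i, 0 <= val b i].

(** The supremum formula for the modulus of a functional on a vector lattice.
    It is meaningful at nonnegative [b] only, and is extended linearly in
    [exists_modulus_functional]. *)
Definition modulus b : R :=
  sup [set f z | z in [set z | forall i, `|val z i| <= val b i]].

Let asum_norm_le z b : (forall i, `|val z i| <= val b i) -> `|z| <= `|b|.
Proof.
move=> zb; apply: aspace_norm_le => i /=.
by rewrite /norms normr_id (le_trans (zb i))// ler_norm.
Qed.

Lemma le_modulus z b : (forall i, `|val z i| <= val b i) -> f z <= modulus b.
Proof.
move=> zb; apply: ub_le_sup; last by exists z.
exists `|b| => _ [y /= yb <-]; apply: (le_trans (ler_norm _)).
exact: le_trans (f_le y) (asum_norm_le yb).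
Qed.

Lemma modulus_le b r : nonneg b ->
  (forall z, (forall i, `|val z i| <= val b i) -> f z <= r) -> modulus b <= r.
Proof.
move=> b0 br; apply: ge_sup => [|_ [z /= zb <-]]; last exact: br.
by exists (f 0); exists 0 => // i; rewrite normr0; exact: b0.
Qed.

Lemma modulus_le_norm b : nonneg b -> modulus b <= `|b|.
Proof.
move=> b0; apply: modulus_le => // z zb; apply: (le_trans (ler_norm _)).
exact: le_trans (f_le z) (asum_norm_le zb).
Qed.

Lemma modulus_ge0 b : nonneg b -> 0 <= modulus b.
Proof.
move=> b0; rewrite -(linear0 f); apply: le_modulus => i.
by rewrite normr0; exact: b0.
Qed.

(** The nontrivial inequality is the Riesz decomposition: a family dominated by
    [a + b] splits into families dominated by [a] and by [b], in the
    proportion [a i : b i] at each coordinate. *)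
Lemma modulusD a b : nonneg a -> nonneg b ->
  modulus (a + b) = modulus a + modulus b.
Proof.
move=> a0 b0; apply/eqP; rewrite eq_le; apply/andP; split.
  apply: modulus_le => [i|z zab].
    by rewrite val_coordD addr_ge0.
  (* where [a i] and [b i] both vanish, so does [z i], and [s i] is 0 *)
  pose s i := val a i / (val a i + val b i).
  have sa i : 0 <= s i by rewrite divr_ge0// addr_ge0.
  have sum_le i : s i * `|val z i| <= val a i /\
      (1 - s i) * `|val z i| <= val b i.
    have := zab i; rewrite val_coordD /s.
    have [ab0|ab0] := eqVneq (val a i + val b i) 0.
      by rewrite ab0 normr_le0 => /eqP ->; rewrite normr0 !mulr0.
    have abgt0 : 0 < val a i + val b i by rewrite lt_def ab0 addr_ge0.
    have -> : 1 - val a i / (val a i + val b i) =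
        val b i / (val a i + val b i) by field.
    rewrite mulrAC [in X in _ /\ X]mulrAC !ler_pdivrMr// => zi.
    by split; rewrite ler_wpM2l.
  have s1 i : 0 <= 1 - s i.
    rewrite /s; have [->|ab0] := eqVneq (val a i + val b i) 0.
      by rewrite invr0 mulr0 subr0.
    rewrite subr_ge0 ler_pdivrMr ?lt_def ?ab0 ?addr_ge0// mul1r.
    by rewrite lerDl.
  have [i|z1 z1E] := @asum_dominated a (fun i => s i *: val z i).
    by rewrite normrZ (ger0_norm (sa i)) (ger0_norm (a0 i)); case: (sum_le i).
  rewrite -(subrKC z1 z) linearD lerD//; apply: le_modulus => i.
    by rewrite z1E normrZ ger0_norm//; case: (sum_le i).
  rewrite asum_coordB z1E -[X in X - _]scale1r -scalerBl normrZ.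
  by rewrite ger0_norm//; case: (sum_le i).
rewrite -lerBrDr; apply: modulus_le => // z za.
rewrite lerBrDl -lerBrDr; apply: modulus_le => // y yb.
rewrite lerBrDr -linearD; apply: le_modulus => i.
rewrite asum_coordD val_coordD [leRHS]addrC (le_trans (ler_normD _ _))//.
exact: lerD.
Qed.

Lemma modulusZ (t : R) b : 0 <= t -> nonneg b ->
  modulus (t *: b) = t * modulus b.
Proof.
have Zle (s : R) a : 0 < s -> nonneg a -> modulus (s *: a) <= s * modulus a.
  move=> s0 a0; apply: modulus_le => [i|z za].
    by rewrite val_coordZ mulr_ge0// ltW.
  rewrite -ler_pdivrMl// -[_ * _]/(s^-1 *: (f z : R^o)) -linearZ.
  apply: le_modulus => i; rewrite asum_coordZ normrZ gtr0_norm ?invr_gt0//.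
  by rewrite ler_pdivrMl// -val_coordZ; exact: za.
rewrite le_eqVlt => /predU1P[<- b0|t0 b0].
  apply/eqP; rewrite scale0r mul0r eq_le modulus_ge0 ?andbT.
    by rewrite (le_trans (modulus_le_norm _)) ?normr0.
  by [].
apply/eqP; rewrite eq_le Zle//= -ler_pdivlMl//.
have tb0 : nonneg (t *: b) by move=> i; rewrite val_coordZ mulr_ge0// ltW.
have := Zle t^-1 _ _ tb0; rewrite scalerA mulVf ?gt_eqF// scale1r invr_gt0.
exact.
Qed.

End modulus.

(** The modulus has norm one since it dominates [f] and is dominated by the
    norm of [E].  It equals the norm of [f_i] at the unit vector [e_i] because
    the families dominated by [e_i] are the vectors of the unit ball of [X i]
    placed at [i]. *)
Lemma exists_modulus_functional (f : {linear asum E X -> R^o}) :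
  dual_unit_sphere f -> exists c : {linear aspace E -> R^o},
  [/\ dual_unit_sphere c, forall z, `|f z| <= c (asum_norms z) &
    forall i, c (unit_vec i) = dual_norm (coord_functional f i)].
Proof.
move=> f1; have fle z : `|f z| <= `|z| by exact: dual_unit_sphere_le.
have [c cE] : exists c : {linear aspace E -> R^o},
    forall b, nonneg b -> c b = modulus f b.
  apply: linear_extension_of_cone.
  - by move=> a b a0 b0 i; rewrite val_coordD addr_ge0.
  - by move=> t b t0 b0 i; rewrite val_coordZ mulr_ge0.
  - move=> b; have [b' b'E _] := aspace_modulus b.
    exists b', (b' - b); split; last by rewrite subKr.
      by move=> i; rewrite b'E.
    by move=> i; rewrite val_coordB b'E subr_ge0 ler_norm.
  - by move=> a b; exact: modulusD.
  - by move=> t b; exact: modulusZ.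
have c0 b : nonneg b -> 0 <= c b by move=> b0; rewrite cE// modulus_ge0.
have c_le b : `|c b| <= 1 * `|b|.
  have [b' b'E <-] := aspace_modulus b.
  have b'0 : nonneg b' by move=> i; rewrite b'E.
  have h1 : 0 <= c (b' - b).
    by apply: c0 => i; rewrite val_coordB b'E subr_ge0 ler_norm.
  have h2 : 0 <= c (b' + b).
    by apply: c0 => i; rewrite val_coordD b'E -lerBlDr sub0r -normrN ler_norm.
  rewrite mul1r (le_trans _ (modulus_le_norm fle b'0))// -cE//.
  move: h1 h2; rewrite linearB linearD => h1 h2.
  by rewrite ler_norml; apply/andP; split; lra.
have norms0 z : nonneg (asum_norms z) by move=> i; rewrite /= normr_ge0.
have fc z : `|f z| <= c (asum_norms z).
  rewrite cE// ler_norml lerNl -linearN.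
  by apply/andP; split; apply: le_modulus => // i; rewrite /= ?normrN.
exists c; split=> // [|i].
  split; first exact: bounded_functional_continuous c_le.
  apply/eqP; rewrite eq_le; apply/andP; split.
    by apply: dual_norm_le => b b1; rewrite (le_trans (c_le b))// mul1r.
  rewrite -{1}f1.2; apply: dual_norm_le => z z1.
  rewrite (le_trans (fc z))// (le_trans (ler_norm _))//.
  exact: le_dual_norm_ball c_le _.
have fi_le (x : X i) : `|coord_functional f i x| <= 1 * `|x|.
  by rewrite mul1r -norm_single; exact: fle.
apply/eqP; rewrite eq_le; apply/andP; split.
  rewrite cE; last exact: unit_vec_ge0.
  apply: modulus_le => [|z zi]; first exact: unit_vec_ge0.
  have -> : z = single (val z i).
    apply: asum_eq => j; have [<-|ij] := pselect (i = j).
      by rewrite single_id.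
    have := zi j; rewrite unit_vecE indicE memNset;
      last by move=> /= ji; exact: ij.
    by rewrite normr_le0 single_neq// => /eqP.
  apply: (le_trans (ler_norm _)); apply: (le_dual_norm_ball fi_le).
  by have := zi i; rewrite unit_vecE indicE mem_set.
apply: dual_norm_le => x x1; apply: (le_trans (fc _)).
rewrite asum_norms_single linearZ -[leRHS]mul1r ler_wpM2r//.
exact: c0 (unit_vec_ge0 i).
Qed.

End absolute_sum.

(** * Restriction to finitely many coordinates *)

(** Sequences with [List.In] stand for finite sets, as [I] is a bare type
    without a boolean equality. *)
Lemma seq_set_ind (I : Type) (P : set I -> Prop) : P set0 ->
  (forall A i, ~ A i -> P A -> P (i |` A)) ->
  forall s : seq I, P [set i | List.In i s].
Proof.
move=> P0 PU; elim=> [|i s IH]; first by rewrite (_ : mkset _ = set0).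
have -> : [set j | List.In j (i :: s)] = i |` [set j | List.In j s].
  by apply/seteqP; split=> j /= [->|]; by [left|right].
have [si|si] := pselect (List.In i s); last exact: PU.
rewrite (_ : i |` _ = [set j | List.In j s])//.
by apply/seteqP; split=> j /=; [case=> [->|]|right].
Qed.

Section restriction.
Variables (R : realType) (I : Type) (E : absNormedSpace R I).
Variable X : I -> completeNormedModType R.
Implicit Types (a b : aspace E) (z : asum E X) (i : I) (A : set I).

Let restrict_subproof A z : exists z' : asum E X,
  val z' = (fun i => if i \in A then val z i else 0).
Proof.
apply: (asum_dominated (b := asum_norms z)) => i.
by case: ifP => _; rewrite /= normr_id// normr0.
Qed.

Definition asum_restrict A z : asum E X := sval (cid (restrict_subproof A z)).

Lemma asum_restrictE A z i :
  val (asum_restrict A z) i = if i \in A then val z i else 0.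
Proof. by rewrite /asum_restrict; case: cid => z' /= ->. Qed.

Lemma asum_restrict0 z : asum_restrict set0 z = 0.
Proof. by apply: asum_eq => i; rewrite asum_restrictE in_set0. Qed.

Lemma asum_restrict1 z i : asum_restrict [set i] z = single E (val z i).
Proof.
apply: asum_eq => j; rewrite asum_restrictE; have [<-|ij] := pselect (i = j).
  by rewrite mem_set// single_id.
by rewrite memNset ?single_neq// => /= ji; exact: ij.
Qed.

Lemma asum_restrictU1 A z i : ~ A i ->
  asum_restrict (i |` A) z = asum_restrict A z + single E (val z i).
Proof.
move=> Ai; apply: asum_eq => j; rewrite asum_coordD !asum_restrictE.
have [<-|ij] := pselect (i = j).
  by rewrite mem_set ?memNset ?add0r ?single_id//; left.
rewrite single_neq// addr0; congr (if _ then _ else _); apply/idP/idP.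
  by move/set_mem => [ji|Aj]; [case: ij|exact: mem_set].
by move/set_mem => Aj; apply: mem_set; right.
Qed.

Lemma asum_norms_val z i : val (asum_norms z) i = `|val z i|.
Proof. by []. Qed.

Lemma asum_norms_restrictU1 A z i : ~ A i ->
  asum_norms (asum_restrict (i |` A) z) =
  asum_norms (asum_restrict A z) + `|val z i| *: unit_vec E i.
Proof.
move=> Ai; rewrite -asum_norms_single; apply: asum_norms_eq => j.
rewrite asum_restrictU1// asum_coordD val_coordD !asum_norms_val.
have [<-|ij] := pselect (i = j); last by rewrite single_neq// normr0 !addr0.
by rewrite asum_restrictE memNset// normr0 !add0r.
Qed.

Lemma asum_norms_restrictC A z : asum_norms (z - asum_restrict A z) =
  asum_norms z - asum_norms (asum_restrict A z).
Proof.
apply: asum_norms_eq => i.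
rewrite asum_coordB val_coordB /= /norms asum_restrictE.
by case: ifP => _; rewrite ?subrr ?normr0 ?subr0.
Qed.

Lemma span_units_support b : span_units b ->
  exists s : seq I, forall i, ~ List.In i s -> val b i = 0.
Proof.
move=> [s [c bE]]; exists s => i; rewrite bE; elim: s {bE} => [|j s IH] si.
  by rewrite big_nil.
rewrite big_cons.
change (c j * \1_[set j] i + (\sum_(k <- s) c k *: \1_[set k]) i = 0).
rewrite IH; last by move=> ?; apply: si; right.
by rewrite indicE memNset ?mulr0 ?addr0// => /= ij; apply: si; left.
Qed.

(** If [b] vanishes off [s], then off [s] the norms of the coordinates of [z]
    are those of [asum_norms z - b], so the tail of [z] is dominated by that
    difference. *)
Lemma restrict_dense z (e : R) : dense (@span_units R I E) -> 0 < e ->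
  exists s : seq I,
    `|asum_norms (z - asum_restrict [set i | List.In i s] z)| <= e.
Proof.
move=> dE e0; have ball0 : ball (asum_norms z) e !=set0.
  by exists (asum_norms z); exact: ballxx.
have [b [zb /span_units_support[s sP]]] := dE _ ball0 (ball_open _ _).
exists s; apply: le_trans (ltW (_ : `|asum_norms z - b| < e)); last first.
  by move: zb; rewrite -ball_normE.
apply: aspace_norm_le => i; rewrite asum_norms_restrictC !val_coordB.
rewrite {2}/asum_norms /= /norms asum_restrictE.
have [si|si] := pselect (List.In i s); first by rewrite mem_set// subrr normr0.
by rewrite memNset// normr0 sP.
Qed.

Lemma asum_coord_le z i : `|val z i| <= `|z|.
Proof.
by apply: le_trans (le_coord_norm (asum_norms z) i); rewrite /= normr_id.
Qed.

Lemma norm_add_asum_norms z z' : `|z + z'| <= `|asum_norms z + asum_norms z'|.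
Proof.
apply: aspace_norm_le => i.
by rewrite val_coordD /= /norms normr_id (ger0_norm (addr_ge0 _ _))// ler_normD.
Qed.

End restriction.

(** * Sequences with a common midpoint limit *)

Lemma cvg_norm_add_midpoint (R : realType) (V : normedModType R)
    (us vs : nat -> V) (x : V) :
  (forall n, `|us n| = 1) -> (forall n, `|vs n| = 1) -> `|x| = 1 ->
  `|x - 2^-1 *: (us n + vs n)| @[n --> \oo] --> (0 : R) ->
  `|us n + x| @[n --> \oo] --> (2 : R).
Proof.
(* [us n + x] differs from [3 *: x - vs n], of norm at least 2, by twice the
   error of the midpoint *)
move=> u1 v1 x1 mid; apply: cvg_from_below => [n|e e0].
  by rewrite (le_trans (ler_normD _ _))// u1 x1.
have e2 : 0 < e / 2 by rewrite divr_gt0.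
move/cvgrPdist_le : mid => /(_ _ e2); apply: filterS => n.
rewrite sub0r normrN normr_id; set m := x - _ => mid.
have xE : 3 *: x - vs n = (us n + x) + 2 *: m.
  rewrite /m scalerBr scalerA divff// scale1r opprD [us n + x]addrC -addrA.
  rewrite [us n + _]addrCA addNKr addrA; congr (_ - _).
  by rewrite -[X in X + _]scale1r -scalerDl; congr (_ *: _); lra.
have := lerB_dist (3 *: x) (vs n); rewrite xE normrZ x1 v1 ger0_norm//.
have := ler_normD (us n + x) (2 *: m); rewrite [X in _ <= _ + X -> _]normrZ.
by rewrite [X in X * _]ger0_norm//; lra.
Qed.

Section midpoint_sequences.
Variables (R : realType) (I : Type) (E : absNormedSpace R I).
Variable X : I -> completeNormedModType R.
Variables (us vs : nat -> asum E X) (x : asum E X).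
Variables (fs : nat -> {linear asum E X -> R^o}).
Variables (cs : nat -> {linear aspace E -> R^o}).
Hypotheses (us1 : forall n, unit_sphere (us n)).
Hypotheses (vs1 : forall n, unit_sphere (vs n)).
Hypotheses (x1 : unit_sphere x) (fs1 : forall n, dual_unit_sphere (fs n)).
Hypothesis cs1 : forall n, dual_unit_sphere (cs n).
Hypothesis fs_le_cs : forall n z, `|fs n z| <= cs n (asum_norms z).
Hypothesis cs_unit : forall n i,
  cs n (unit_vec E i) = dual_norm (coord_functional (fs n) i).
Hypothesis mid : `|x - 2^-1 *: (us n + vs n)| @[n --> \oo] --> (0 : R).
Hypothesis fs_us : fs n (us n) @[n --> \oo] --> (1 : R).

Lemma cvg_norm_add_asum_norms :
  `|asum_norms (us n) + asum_norms x| @[n --> \oo] --> (2 : R).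
Proof.
apply: cvg_from_below => [n|e e0].
  by rewrite (le_trans (ler_normD _ _))// -!asum_normE us1 x1.
have /cvgrPdist_le/(_ e e0) := cvg_norm_add_midpoint us1 vs1 x1 mid.
apply: filterS => n; rewrite ler_norml => /andP[_].
have := norm_add_asum_norms (us n) x; lra.
Qed.

Lemma cvg_modulus_functional :
  cs n (asum_norms (us n)) @[n --> \oo] --> (1 : R).
Proof.
apply: cvg_from_below => [n|e e0].
  exact: dual_unit_sphere_le1 (cs1 n) (us1 n).
move/cvgrPdist_le : fs_us => /(_ e e0); apply: filterS => n.
rewrite ler_norml => /andP[_].
have := le_trans (ler_norm _) (fs_le_cs n (us n)); lra.
Qed.

Hypothesis us_coord : forall i, `|val (us n) i| @[n --> \oo] --> `|val x i|.
Hypothesis vs_coord : forall i, `|val (vs n) i| @[n --> \oo] --> `|val x i|.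
Hypothesis coord_mid : forall i, val x i != 0 ->
  midpoint_acs (normalisations [set coord_functional (fs n) i | n in setT])
    (`|val x i|^-1 *: val x i).

(** Removing the coordinate [i] from [us n] leaves at most
    [cs n (asum_norms (us n)) - `|us n i| * cs n e_i] of [fs n (us n)], and
    [cs n (asum_norms (us n)) <= 1].  As [fs n (us n)] tends to 1, the
    coordinate functional almost attains its norm at [us n i]; the property of
    [X i] carries this over to [vs n i]. *)
Lemma near_coord_functional i (e : R) : 0 < e -> \forall n \near \oo,
  `|val (vs n) i| * cs n (unit_vec E i) - e <= fs n (single E (val (vs n) i)).
Proof.
move=> e0; have [|d d0 dP] := midpoint_acs_homogeneous _ (@coord_mid i) e0.
  move=> _ y [n _ <-]; rewrite -(norm_single E y).
  exact: (dual_unit_sphere_le (single E y) (fs1 n)).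
have /cvgrPdist_le/(_ d d0) U := @us_coord i.
have /cvgrPdist_le/(_ d d0) V := @vs_coord i.
have /cvgrPdist_le/(_ d d0) M := mid.
have /cvgrPdist_le/(_ d d0) FU := fs_us.
near=> n; rewrite cs_unit mulrC.
apply: (dP (val (us n) i) (val (vs n) i) (coord_functional (fs n) i)).
- by exists n.
- by rewrite distrC; near: n.
- by rewrite distrC; near: n.
- apply: (le_trans (asum_coord_le (x - 2^-1 *: (us n + vs n)) i)).
  by have : `|0 - `|x - 2^-1 *: (us n + vs n)| | <= d; [near: n|
    rewrite sub0r normrN normr_id].
have fu : 1 - fs n (us n) <= d.
  by apply: (le_trans (ler_norm _)); near: n.
have cu : cs n (asum_norms (us n)) <= 1.
  exact: dual_unit_sphere_le1 (cs1 n) (us1 n).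
have := le_trans (ler_norm _)
  (fs_le_cs n (us n - asum_restrict [set i] (us n))).
rewrite asum_norms_restrictC linearB asum_restrict1 asum_norms_single.
rewrite [cs n (_ - _)]linearB linearZ cs_unit => le1.
change (is_true (fs n (us n) - fs n (single E (val (us n) i)) <=
  cs n (asum_norms (us n)) -
  `|val (us n) i| * dual_norm (coord_functional (fs n) i))) in le1.
change (is_true (dual_norm (coord_functional (fs n) i) * `|val (us n) i| - d <=
  fs n (single E (val (us n) i)))).
by move: fu cu le1; lra.
Unshelve. all: by end_near. Qed.

Lemma near_restrict (s : seq I) (e : R) : 0 < e -> \forall n \near \oo,
  cs n (asum_norms (asum_restrict [set i | List.In i s] (vs n))) - e <=
  fs n (asum_restrict [set i | List.In i s] (vs n)).
Proof.
move: s e; apply: (@seq_set_ind _ (fun A => forall e : R, 0 < e ->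
  \forall n \near \oo, cs n (asum_norms (asum_restrict A (vs n))) - e <=
    fs n (asum_restrict A (vs n)))).
  move=> e e0; apply: nearW => n; rewrite asum_restrict0 linear0.
  rewrite (_ : asum_norms 0 = 0) ?linear0 ?sub0r ?oppr_le0 ?ltW//.
  by apply: asum_norms_eq => i; rewrite normr0.
move=> A i Ai IH e e0; have e2 : 0 < e / 2 by rewrite divr_gt0.
near=> n; rewrite asum_norms_restrictU1// asum_restrictU1// !linearD linearZ.
have h1 : cs n (asum_norms (asum_restrict A (vs n))) - e / 2 <=
    fs n (asum_restrict A (vs n)).
  by near: n; exact: IH.
have h2 : `|val (vs n) i| * cs n (unit_vec E i) - e / 2 <=
    fs n (single E (val (vs n) i)).
  by near: n; exact: near_coord_functional.
change (is_true (cs n (asum_norms (asum_restrict A (vs n))) +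
  `|val (vs n) i| * cs n (unit_vec E i) - e <=
  fs n (asum_restrict A (vs n)) + fs n (single E (val (vs n) i)))).
by move: h1 h2; lra.
Unshelve. all: by end_near. Qed.

Lemma cvg_restrict (s : seq I) :
  asum_norms (asum_restrict [set i | List.In i s] (vs n)) @[n --> \oo] -->
  asum_norms (asum_restrict [set i | List.In i s] x).
Proof.
move: s; apply: (@seq_set_ind _ (fun A =>
  asum_norms (asum_restrict A (vs n)) @[n --> \oo] -->
  asum_norms (asum_restrict A x))).
  under eq_fun do rewrite asum_restrict0.
  by rewrite asum_restrict0; exact: cvg_cst.
move=> A i Ai IH; under eq_fun do rewrite asum_norms_restrictU1//.
rewrite asum_norms_restrictU1//; apply: cvgD => //.
by apply: cvgZr_tmp; exact: vs_coord.
Qed.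

(** With [A] finite and [v] standing for [vs n], the domination of [fs n] by
    [cs n] off [A] gives
    [fs n v >= fs n v_A - (cs n (norms v) - cs n (norms v_A))], whose right
    hand side is close to [2 * cs n (norms v_A) - cs n (norms v)], hence at
    least [2 * cs n (norms x_A) - 1] up to a small error. *)
Lemma cvg_functional_midpoint : dense (@span_units R I E) ->
  cs n (asum_norms x) @[n --> \oo] --> (1 : R) ->
  fs n (vs n) @[n --> \oo] --> (1 : R).
Proof.
move=> dE cx; apply: cvg_from_below => [n|e e0].
  exact: dual_unit_sphere_le1.
(* four errors occur, three of which are counted twice *)
have e7 : 0 < e / 7 by rewrite divr_gt0.
have [s sx] := restrict_dense x dE e7; set A := [set i | _] in sx.
have /cvgrPdist_le/(_ _ e7) C1 := cx.
have /cvgrPdist_le/(_ _ e7) C2 := @cvg_restrict s.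
have F1 := near_restrict s e7.
near=> n.
have c_le b : `|cs n b| <= `|b| by exact: dual_unit_sphere_le.
have h1 : cs n (asum_norms (asum_restrict A (vs n))) - e / 7 <=
    fs n (asum_restrict A (vs n)).
  by near: n.
have h2 : 1 - cs n (asum_norms x) <= e / 7.
  by apply: (le_trans (ler_norm _)); near: n.
have h3 : `|asum_norms (asum_restrict A x) -
    asum_norms (asum_restrict A (vs n))| <= e / 7.
  by near: n.
have h4 : cs n (asum_norms (vs n)) <= 1.
  exact: dual_unit_sphere_le1 (cs1 n) (vs1 n).
have := le_trans (ler_norm _) (le_trans (c_le _) h3).
have := le_trans (ler_norm _) (le_trans (c_le _) sx).
have := fs_le_cs n (vs n - asum_restrict A (vs n)).
rewrite !asum_norms_restrictC !linearB ler_norml => /andP[h5 _] h6 h7.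
change (is_true (- (cs n (asum_norms (vs n)) -
  cs n (asum_norms (asum_restrict A (vs n)))) <=
  fs n (vs n) - fs n (asum_restrict A (vs n)))) in h5.
change (is_true (cs n (asum_norms x) -
  cs n (asum_norms (asum_restrict A x)) <= e / 7)) in h6.
change (is_true (cs n (asum_norms (asum_restrict A x)) -
  cs n (asum_norms (asum_restrict A (vs n))) <= e / 7)) in h7.
by move: h1 h2 h4 h5 h6 h7; lra.
Unshelve. all: by end_near. Qed.

End midpoint_sequences.

(** * The midpoint properties of absolute sums *)

Section absolute_sums.
Variables (R : realType) (I : Type) (E : absNormedSpace R I).
Variable X : I -> completeNormedModType R.
Hypotheses (E_dense : dense (@span_units R I E)) (E_P : property_P E).

(** The reduction of the midpoint property of the sum, relative to a set [F] of
    functionals, to the property of [E] relative to the moduli of the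
    functionals in [F] and to the properties of the [X i] relative to their
    normalised coordinate functionals. *)
Lemma absolute_sum_midpoint (F : set {linear asum E X -> R^o}) (x : asum E X)
    (c : {linear asum E X -> R^o} -> {linear aspace E -> R^o}) :
  unit_sphere x -> F `<=` @dual_unit_sphere R (asum E X) ->
  (forall f, F f -> [/\ dual_unit_sphere (c f),
    forall z, `|f z| <= c f (asum_norms z) &
    forall i, c f (unit_vec E i) = dual_norm (coord_functional f i)]) ->
  (forall i, val x i != 0 ->
    midpoint_acs (normalisations [set coord_functional f i | f in F])
      (`|val x i|^-1 *: val x i)) ->
  (forall (an : nat -> aspace E) (fs : nat -> {linear asum E X -> R^o}),
    (forall n, unit_sphere (an n)) -> (forall n, F (fs n)) ->
    `|an n + asum_norms x| @[n --> \oo] --> (2 : R) ->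
    c (fs n) (an n) @[n --> \oo] --> (1 : R) ->
    c (fs n) (asum_norms x) @[n --> \oo] --> (1 : R)) ->
  midpoint_acs F x.
Proof.
move=> x1 F1 cP Xmid EP us vs fs us1 vs1 Ffs mid fsus.
have cs1 n : dual_unit_sphere (c (fs n)) by case: (cP _ (Ffs n)).
have fs_le n z : `|fs n z| <= c (fs n) (asum_norms z).
  by case: (cP _ (Ffs n)) => _ + _; exact.
have cs_unit n i : c (fs n) (unit_vec E i) =
    dual_norm (coord_functional (fs n) i).
  by case: (cP _ (Ffs n)) => _ _; exact.
have mid' : `|x - 2^-1 *: (vs n + us n)| @[n --> \oo] --> (0 : R).
  by under eq_fun => n do rewrite (addrC (vs n)).
have cvgP ws ws' : (forall n, unit_sphere (ws n)) ->
    (forall n, unit_sphere (ws' n)) ->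
    `|x - 2^-1 *: (ws n + ws' n)| @[n --> \oo] --> (0 : R) ->
    forall i, `|val (ws n) i| @[n --> \oo] --> `|val x i|.
  move=> ws1 ws'1 wmid i.
  apply: (E_P (an := fun n => asum_norms (ws n)) (a := asum_norms x)) => //.
  exact: cvg_norm_add_asum_norms ws1 ws'1 x1 wmid.
apply: (@cvg_functional_midpoint _ _ _ _ us vs x fs (fun n => c (fs n))) => //.
- by move=> n; exact: F1.
- exact: cvgP us1 vs1 mid.
- exact: cvgP vs1 us1 mid'.
- move=> i xi; apply: sub_midpoint_acs (Xmid i xi).
  move=> _ [_ [[n _ <-] fi0 ->]].
  exists (coord_functional (fs n) i); split=> //.
  by exists (fs n).
- apply: (EP (fun n => asum_norms (us n))) => //.
  + exact: cvg_norm_add_asum_norms us1 vs1 x1 mid.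
  + exact: cvg_modulus_functional us1 cs1 fs_le fsus.
Qed.

Lemma unit_direction i (x : asum E X) : val x i != 0 ->
  unit_sphere (`|val x i|^-1 *: val x i).
Proof.
rewrite -normr_eq0 => xi.
by rewrite /unit_sphere/= normrZ normfV normr_id mulVf.
Qed.

Lemma coord_functional_le f i y : dual_unit_sphere f ->
  `|coord_functional (f : {linear asum E X -> R^o}) i y| <= 1 * `|y|.
Proof.
move=> f1; rewrite mul1r -(norm_single E y).
exact: (dual_unit_sphere_le (single E y) f1).
Qed.

Lemma exists_modulus_map :
  exists c : {linear asum E X -> R^o} -> {linear aspace E -> R^o},
  forall f, dual_unit_sphere f -> [/\ dual_unit_sphere (c f),
    forall z, `|f z| <= c f (asum_norms z) &
    forall i, c f (unit_vec E i) = dual_norm (coord_functional f i)].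
Proof.
have H (f : {linear asum E X -> R^o}) : exists c : {linear aspace E -> R^o},
    dual_unit_sphere f -> [/\ dual_unit_sphere c,
      forall z, `|f z| <= c (asum_norms z) &
      forall i, c (unit_vec E i) = dual_norm (coord_functional f i)].
  have [/exists_modulus_functional[c cP]|nf] := pselect (dual_unit_sphere f).
    by exists c.
  by exists \0.
by have [c cP] := choice H; exists c.
Qed.

Lemma asum_msluacs : (forall i, msluacs (X i)) -> sluacs (aspace E) ->
  msluacs (asum E X).
Proof.
move=> Xm Es us vs x fs us1 vs1 x1 fs1; have [c cP] := exists_modulus_map.
apply: (@absolute_sum_midpoint (@dual_unit_sphere R (asum E X)) x c) => //.
- move=> i xi; apply: (sub_midpoint_acs (G := @dual_unit_sphere R (X i))).
    by apply: normalisations_sub => _ y [f f1 <-]; exact: coord_functional_le.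
  by apply: msluacs_midpoint_acs => //; exact: unit_direction.
- move=> an gs an1 gs1; apply: Es => // n; by case: (cP _ (gs1 n)).
Qed.

Lemma asum_mluacs : (forall i, mluacs (X i)) -> luacs (aspace E) ->
  mluacs (asum E X).
Proof.
move=> Xm El us vs x f us1 vs1 x1 f1; have [c cP] := exists_modulus_map.
apply: (@absolute_sum_midpoint [set f] x c _ _ _ _ _ us vs (fun=> f)) => //.
- by move=> _ ->.
- by move=> _ ->; exact: cP.
- move=> i xi; set g : {linear X i -> R^o} :=
    (dual_norm (coord_functional f i))^-1 \*: coord_functional f i.
  have [fi0|fi0] := eqVneq (dual_norm (coord_functional f i)) 0.
    (* there are no normalised coordinate functionals at [i] *)
    move=> ws ws' gs _ _ /(_ 0)[_ [[_ -> <-]]].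
    by rewrite fi0 eqxx.
  apply: (sub_midpoint_acs (G := [set g])).
    by move=> _ [_ [[_ -> <-] _ ->]].
  apply: mluacs_midpoint_acs => //; first exact: unit_direction.
  by apply: normalised_functional fi0 => y; exact: coord_functional_le.
- move=> an gs an1 gsE; have -> : gs = (fun=> f) by exact/funext.
  move=> an2 can; rewrite (El _ _ _ _ an1 _ an2 can) //; first exact: cvg_cst.
  by case: (cP f f1).
Qed.

End absolute_sums.

Theorem proposition4p9 (R : realType) (I : Type) (I_nonempty : [set: I] !=set0)
    (E : absNormedSpace R I) (E_dense : dense (@span_units R I E))
    (X : I -> completeNormedModType R) (E_P : property_P E) :
  ((forall i, msluacs (X i)) -> sluacs (aspace E) -> msluacs (asum E X)) /\
  ((forall i, mluacs (X i)) -> luacs (aspace E) -> mluacs (asum E X)).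
Proof.
split; [exact: asum_msluacs|exact: asum_mluacs].
Qed.
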